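(* Let $G$ be a connected split graph that is not a tree, with vertex set partitioned into a clique $X$ and an independent set $Y$. Then $\sigma_T(G)=2$ if and only if there exists a vertex $x_0\in X$ such that every vertex $y\in Y\setminus N_G(x_0)$ is a pendant vertex (i.e. has degree one in $G$). Otherwise $\sigma_T(G)=3$.
   Context: All graphs are finite and simple. For a connected graph $G$ (with at least one edge) and a spanning tree $T$ of $G$, let $d_T(u,v)$ be the distance between $u$ and $v$ in $T$. The stretch of $T$ is $\sigma_T(G,T):=\max_{uv\in E(G)} d_T(u,v)$, and the tree-stretch of $G$ is $\sigma_T(G):=\min\{\sigma_T(G,T): T \text{ is a spanning tree of } G\}$ (the subscript $T$ in $\sigma_T(G)$ is part of the notation and does not refer to a particular tree). A graph $G$ is a split graph if $V(G)$ can be partitioned into a clique $X$ of $G$ (pairwise adjacent vertices) and an independent set $Y$ of $G$ (pairwise nonadjacent vertices). $N_G(v)$ denotes the set of neighbors of $v$ in $G$. *)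

(* Defs.v *)
From mathcomp Require Import all_boot.

Set Implicit Arguments.
Unset Strict Implicit.
Unset Printing Implicit Defensive.

Section Graphs.
Variable V : finType.
Implicit Types (e : rel V) (T : {set {set V}}) (X Y : {set V}).

Definition simple_graph e := symmetric e /\ irreflexive e.

Definition nbhd e (v : V) : {set V} := [set w | e v w].

Definition degree e (v : V) : nat := #|nbhd e v|.

Definition pendant e (v : V) : bool := degree e v == 1.

Definition clique e X := {in X &, forall u v, u != v -> e u v}.

Definition independent e Y := {in Y &, forall u v, ~~ e u v}.

Definition split_partition e X Y :=
  [/\ X :|: Y = [set: V], [disjoint X & Y], clique e X & independent e Y].

(* The empty graph does not count as connected. *)
Definition connected_graph e : bool :=
  (0 < #|V|) && [forall u, forall v, connect e u v].

(* A cycle has at least 3 vertices; as it has no repeated vertex, bounding its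
   length by #|V| loses nothing (see acyclicP). *)
Definition acyclic e : bool :=
  [forall n : 'I_#|V|.+1, forall p : n.-tuple V, (2 < n) ==> ~~ ucycleb e p].

Definition is_tree e : bool := connected_graph e && acyclic e.

Definition walk_of_length e (u v : V) (n : nat) : bool :=
  [exists p : n.-tuple V, path e u p && (last u p == v)].

(* Length of a shortest walk; equal to #|V| when v is not reachable from u
   (see distP and dist_unreachable). *)
Definition dist e (u v : V) : nat := find (walk_of_length e u v) (iota 0 #|V|).

Definition edges e : {set {set V}} := [set [set p.1; p.2] | p : V * V & e p.1 p.2].

Definition adj T : rel V := [rel u v | (u != v) && ([set u; v] \in T)].

Definition spanning_tree e T : bool := (T \subset edges e) && is_tree (adj T).

Definition stretch e T : nat := \max_(p : V * V | e p.1 p.2) dist (adj T) p.1 p.2.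

(* Stretches never exceed #|V|, so the base value of this iterated minimum is
   irrelevant as soon as there is a spanning tree (see tree_stretch_attained). *)
Definition tree_stretch e : nat :=
  \big[minn/#|V|]_(T : {set {set V}} | spanning_tree e T) stretch e T.

Lemma acyclicP e : reflect (forall p, ucycle e p -> size p <= 2) (acyclic e).
Proof.
apply: (iffP forallP) => [H p cp | H n].
  have lep : size p < #|V|.+1.
    by rewrite ltnS -(card_uniqP (ucycle_uniq cp)) max_card.
  move/forallP/(_ (in_tuple p)): (H (Ordinal lep)) => /=.
  by rewrite ltnNge; case: leqP => //= _ /negP; case.
apply/forallP => p; apply/implyP => n2; apply/negP => cp.
by have := H _ cp; rewrite size_tuple leqNgt n2.
Qed.

Lemma walkP e u v n :
  reflect (exists p, [/\ size p = n, path e u p & last u p = v])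
          (walk_of_length e u v n).
Proof.
apply: (iffP existsP) => [[p /andP[pp /eqP pl]] | [p [<- pp pl]]].
  by exists p; rewrite size_tuple.
by exists (in_tuple p); rewrite /= pp pl eqxx.
Qed.

Lemma dist_le e u v : dist e u v <= #|V|.
Proof. by rewrite -[leqRHS](size_iota 0) find_size. Qed.

Lemma distP e u v : connect e u v ->
  walk_of_length e u v (dist e u v) /\
  (forall n, walk_of_length e u v n -> dist e u v <= n).
Proof.
move=> /connectP[p0 /shortenP[p pp up _] lp].
have szp : size p < #|V| by rewrite -[_.+1]/(size (u :: p)) -(card_uniqP up) max_card.
have hasw : has (walk_of_length e u v) (iota 0 #|V|).
  by apply/hasP; exists (size p); [rewrite mem_iota | apply/walkP; exists p].
split=> [|n wn].
  have := nth_find 0 hasw; rewrite nth_iota ?add0n //.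
  by move: hasw; rewrite has_find size_iota.
rewrite leqNgt; apply/negP => lt_n; have := before_find 0 lt_n.
by rewrite nth_iota ?add0n ?wn // (leq_trans lt_n (dist_le _ _ _)).
Qed.

Lemma dist_unreachable e u v : ~~ connect e u v -> dist e u v = #|V|.
Proof.
move=> nc; rewrite -[RHS](size_iota 0) /dist hasNfind //.
apply: contra nc => /hasP[n _ /walkP[p [_ pp <-]]].
by apply/connectP; exists p.
Qed.

Lemma mem_edges e u v : symmetric e -> ([set u; v] \in edges e) = e u v.
Proof.
move=> sym_e; apply/imsetP/idP => [[[a b]] /= | euv]; last by exists (u, v); rewrite ?inE.
rewrite inE /= => eab Euv.
have: (a \in [set u; v]) && (b \in [set u; v]) by rewrite Euv !inE !eqxx orbT.
have: (u \in [set a; b]) && (v \in [set a; b]) by rewrite -Euv !inE !eqxx orbT.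
rewrite !inE => /andP[/orP[]/eqP-> /orP[]/eqP->] /andP[/orP[]/eqP ? /orP[]/eqP ?];
  by subst; first [exact: eab | rewrite sym_e].
Qed.

Lemma stretch_le e T : stretch e T <= #|V|.
Proof. by apply/bigmax_leqP => p _; apply: dist_le. Qed.

Lemma tree_stretch_min e T : spanning_tree e T -> tree_stretch e <= stretch e T.
Proof.
move=> sT; rewrite /tree_stretch; have := mem_index_enum T.
elim: (index_enum _) => [//|T' s IHs]; rewrite inE big_cons.
case/predU1P => [<-|/IHs le_s]; first by rewrite sT geq_minl.
by case: ifP => // _; apply: leq_trans le_s; apply: geq_minr.
Qed.

Lemma tree_stretch_attained e T0 : spanning_tree e T0 ->
  exists2 T, spanning_tree e T & tree_stretch e = stretch e T.
Proof.
move=> sT0; case: (arg_minnP (stretch e) sT0) => T sT minT; exists T => //.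
apply/eqP; rewrite eqn_leq tree_stretch_min //= /tree_stretch.
by elim/big_ind: _ => [|m n le_m le_n|T' /minT//]; rewrite ?stretch_le // leq_min le_m.
Qed.

End Graphs.

(* Main.v *)
Require Import Defs.
From mathcomp Require Import all_boot.

Set Implicit Arguments.
Unset Strict Implicit.
Unset Printing Implicit Defensive.

(** The stretch is at least 2 because the edges of a tree of stretch 1 would
    make up the whole graph ([stretch_gt1]). It is at most 3 because any [x0]
    in X roots a spanning tree T of depth 2, in which the rest of X and the
    other neighbors of [x0] are children of [x0] and each remaining vertex is a child
    of one of its neighbors in X. An edge of T-distance 3 joins a remaining
    vertex to a neighbor other than its parent, and a pendant vertex has no such
    neighbor ([split_spanning_tree]). Hence the condition on [x0] suffices for
    stretch 2.

    Conversely, in a tree T of stretch 2 the points of X are pairwise at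
    T-distance at most 2, so they lie in the closed T-neighborhood of one vertex
    c ([tree_diameter2_center]). Take [x0] to be c if c is in X, and any point
    of X otherwise. A vertex y of Y not adjacent to [x0] has a T-neighbor a in
    X, distinct from c; any further neighbor b of y would be at T-distance 3
    from y, along y, a, c, b ([stretch2_center]). Both steps measure distances
    in T by exhibiting a simple path: in a forest it is the only one between
    its ends, hence a shortest one ([acyclic_path_geodesic]). *)

(** * Distances in connected graphs and in forests *)

Section Distance.
Variable V : finType.
Implicit Types (e : rel V) (u v w : V) (p q : seq V).

Lemma connected_graph_connect e u v : connected_graph e -> connect e u v.
Proof. by case/andP=> _ /forallP/(_ u)/forallP/(_ v). Qed.

Lemma connected_has_neighbor e u v :
  connected_graph e -> u != v -> exists w, e u w.
Proof.
move=> /(connected_graph_connect u v)/connectP[[|w p] /=]; first by move=> _ -> /eqP.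
by case/andP=> euw _ _ _; exists w.
Qed.

Lemma dist_le_path e u p : path e u p -> dist e u (last u p) <= size p.
Proof.
move=> pp; have /distP[_] : connect e u (last u p) by apply/connectP; exists p.
by apply; apply/walkP; exists p.
Qed.

(** If two simple paths from [u] diverge at once, towards [x] and [y], going
    forth along one and back along the other links [x] to [y] without
    meeting [u]; a simple such link closes up at [u] into a cycle. *)
Lemma acyclic_path_unique e u p q :
    symmetric e -> acyclic e ->
    path e u p -> uniq (u :: p) -> path e u q -> uniq (u :: q) ->
  last u p = last u q -> p = q.
Proof.
move=> sym_e /acyclicP acyc_e; elim: p u q => [|x p IHp] u [|y q] //.
- by move=> _ _ _ /andP[uNq _] /= Eu; case/negP: uNq; rewrite Eu mem_last.
- by move=> _ /andP[uNp _] _ _ /= Eu; case/negP: uNp; rewrite -Eu mem_last.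
move=> /= /andP[eux pp] /andP[uNp up] /andP[euy pq] /andP[uNq uq] Elast.
have [Exy|neq_xy] := eqVneq x y.
  by rewrite -Exy in pq uq Elast *; rewrite (IHp x q).
have pr : path e x (p ++ rev (belast y q)).
  by rewrite cat_path pp Elast rev_path /=; under eq_path do rewrite sym_e.
have uNr : u \notin x :: p ++ rev (belast y q).
  rewrite -cat_cons mem_cat mem_rev negb_or uNp /=.
  by apply: contra uNq => /mem_belast.
have Er : last x (p ++ rev (belast y q)) = y.
  rewrite last_cat Elast; case: (q) => [|z s] //=.
  by rewrite rev_cons last_rcons.
case/shortenP: pr Er => r pr ur sub_r Er.
have: size [:: u, x & r] <= 2.
  apply: acyc_e; rewrite /ucycle /= rcons_path eux pr Er sym_e euy.
  move: ur uNr; rewrite /= !inE !negb_or => -> /andP[-> uNr] /=.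
  by rewrite andbT; apply: contra uNr => /sub_r.
by case: (r) Er neq_xy => //= ->; rewrite eqxx.
Qed.

Lemma acyclic_path_geodesic e u p :
    symmetric e -> acyclic e -> path e u p -> uniq (u :: p) ->
  size p <= dist e u (last u p).
Proof.
move=> sym_e acyc_e pp up.
have /distP[/walkP[q [<- pq Eq]] _] : connect e u (last u p).
  by apply/connectP; exists p.
case/shortenP: pq Eq => q' pq' uq' /(uniq_leq_size (proj2 (andP uq'))) le_q' Eq.
by rewrite (@acyclic_path_unique e u p q').
Qed.

Lemma dist_le1_adj e u v :
  connect e u v -> u != v -> dist e u v <= 1 -> e u v.
Proof.
case/distP=> /walkP[p [<- pp <-]] _.
by case: p pp => [|w [|//]] /=; rewrite ?eqxx ?andbT.
Qed.

Lemma dist_le2_via e u v : connect e u v -> u != v -> dist e u v <= 2 ->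
  e u v \/ exists2 w, e u w & e w v.
Proof.
case/distP=> /walkP[p [<- pp <-]] _.
case: p pp => [|w [|z [|//]]] /=; rewrite ?eqxx ?andbT //; first by left.
by case/andP=> euw ewz; right; exists w.
Qed.

(** Going up a parent map [f] strictly decreases the rank [h], so a vertex of
    maximal rank on a cycle has no neighbor there but its parent, whereas a
    cycle of length at least 3 gives it two. *)
Lemma parent_graph_acyclic e (f : V -> V) (h : V -> nat) :
    (forall u v, e u v -> f u = v /\ h v < h u \/ f v = u /\ h u < h v) ->
  acyclic e.
Proof.
move=> parent_e; apply/acyclicP=> p /andP[cp up]; rewrite leqNgt.
apply/negP=> size_p; have [v0 v0p] : exists v, v \in p.
  by case: p size_p {cp up} => // v p _; exists v; rewrite mem_head.
have [v vp max_v] := arg_maxnP h v0p.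
case: (rot_to vp) => i s Es.
have max_s w : w \in v :: s -> h w <= h v.
  by rewrite -Es mem_rot; apply: max_v.
move: cp up size_p; rewrite -(rot_cycle i) -(rot_uniq i) -(size_rot i p) Es.
case: s max_s {Es} => [|a [|b s]] // max_s.
rewrite [cycle _ _]/= rcons_path => /and3P[eva _ /andP[_ elv]] uvs _.
have nbr w : w \in [:: v, a, b & s] -> e v w \/ e w v -> f v = w.
  move=> /max_s; rewrite leqNgt => /negP leh.
  by case=> /parent_e[] [] // _ /leh.
have Ea : f v = a by apply: nbr; [rewrite !inE eqxx orbT | left].
have lastin : last b s \in b :: s by apply: mem_last.
have El : f v = last b s.
  by apply: nbr; [rewrite 2!in_cons lastin !orbT | right].
by case/andP: uvs => _ /andP[/negP[]]; rewrite -Ea El.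
Qed.

End Distance.

(** * Spanning trees *)

Section SpanningTrees.
Variable V : finType.
Implicit Types (e r : rel V) (u v w : V) (T : {set {set V}}).

Lemma adj_sym T : symmetric (adj T).
Proof. by move=> u v; rewrite /adj /= eq_sym setUC. Qed.

Lemma adj_edges r : simple_graph r -> adj (edges r) =2 r.
Proof.
case=> sym_r irr_r u v; rewrite /adj /= mem_edges //.
by case: eqVneq => // ->; rewrite irr_r.
Qed.

Lemma spanning_tree_sub e T u v :
  symmetric e -> spanning_tree e T -> adj T u v -> e u v.
Proof.
move=> sym_e /andP[/subsetP sub_T _] /andP[_ /sub_T].
by rewrite mem_edges.
Qed.

Lemma spanning_tree_connect e T u v : spanning_tree e T -> connect (adj T) u v.
Proof. by case/and3P=> _ /connected_graph_connect. Qed.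

Lemma spanning_tree_geodesic e T u p : spanning_tree e T ->
  path (adj T) u p -> uniq (u :: p) -> size p <= dist (adj T) u (last u p).
Proof.
by case/and3P=> _ _ acycT; apply: acyclic_path_geodesic => //; apply: adj_sym.
Qed.

Lemma dist_le_stretch e T u v : e u v -> dist (adj T) u v <= stretch e T.
Proof. by move=> euv; apply: (leq_bigmax_cond (u, v)). Qed.

(** A spanning tree of stretch at most 1 contains all the edges, so that the
    graph itself is acyclic. *)
Lemma stretch_gt1 e T : simple_graph e -> connected_graph e -> ~~ is_tree e ->
  spanning_tree e T -> 1 < stretch e T.
Proof.
move=> [_ irr_e] conn_e not_tree sT; rewrite ltnNge; apply/negP=> le1.
have sub_e : subrel e (adj T).
  move=> u v euv; apply: dist_le1_adj; first exact: spanning_tree_connect sT.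
    by apply: contraTneq euv => ->; rewrite irr_e.
  exact: leq_trans (dist_le_stretch T euv) le1.
case/negP: not_tree; rewrite /is_tree conn_e; apply/acyclicP=> p /andP[cp up].
case/and3P: sT => _ _ /acyclicP; apply.
by rewrite /ucycle up andbT (sub_cycle sub_e).
Qed.

(** The midpoint property of trees: a set of T-diameter at most 2 lies in a
    closed T-neighborhood. Any vertex far from the proposed center produces a
    simple path of length 3 or 4 between two points of the set. *)
Lemma tree_diameter2_center e T (X : {set V}) x1 :
    spanning_tree e T -> x1 \in X ->
    {in X &, forall u v, u != v -> dist (adj T) u v <= 2} ->
  exists c, {in X, forall x, x != c -> adj T x c}.
Proof.
move=> sT x1X diamX; have aC := adj_sym T.
have near u v : u \in X -> v \in X -> u != v ->
    adj T u v \/ exists2 w, adj T u w & adj T w v.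
  move=> uX vX neq_uv; apply: dist_le2_via (diamX u v uX vX neq_uv) => //.
  exact: spanning_tree_connect sT.
have short u p : u \in X -> last u p \in X -> path (adj T) u p ->
    uniq (u :: p) -> 2 < size p -> False.
  move=> uX lX pp up size_p; have neq_ul : u != last u p.
    case: p up size_p {pp lX} => // w p /andP[uNp _] _.
    by apply: contraNneq uNp => {1}->; apply: (mem_last w).
  have := leq_trans (spanning_tree_geodesic sT pp up) (diamX _ _ uX lX neq_ul).
  by rewrite leqNgt size_p.
have neqT u v : adj T u v -> u != v by case/andP.
have nbrNeq u v w : adj T u w -> ~~ adj T v w -> u != v.
  by move=> uw; apply: contraNneq => <-.
(* Otherwise [d, z, a, b] would be a simple path for some [z]. *)
have edge_near a b d : a \in X -> b \in X -> adj T a b -> d \in X ->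
    d != a -> ~~ adj T d a -> adj T d b.
  move=> aX bX ab dX neq_da nda.
  have [/(negP nda)//|[z dz za]] := near d a dX aX neq_da.
  have [<-//|neq_zb] := eqVneq z b.
  have neq_bd : b != d by apply: nbrNeq nda; rewrite aC.
  case: (@short d [:: z; a; b]) => //=; first by rewrite dz za ab.
  by rewrite !inE !negb_or neqT // neq_da eq_sym neq_bd neqT // neq_zb neqT.
have [/exists_inP[a aX /exists_inP[b bX ab]]|noedge] :=
    boolP [exists a in X, exists b in X, adj T a b].
  (* One of the two ends of an edge within X is a center. *)
  have [/forall_inP cent|] := boolP [forall x in X, (x != a) ==> adj T x a].
    by exists a => x xX; apply/implyP/cent.
  case/forall_inPn=> d dX; rewrite negb_imply => /andP[neq_da nda].
  have db := edge_near a b d aX bX ab dX neq_da nda.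
  exists b => x xX neq_xb; apply/idPn=> nxb.
  have xa : adj T x a by apply: (edge_near b) => //; rewrite aC.
  have neq_dx : d != x by apply: nbrNeq nxb.
  case: (@short x [:: a; b; d]) => //=; first by rewrite xa ab aC db.
  rewrite !inE !negb_or neqT // neq_xb eq_sym neq_dx neqT // eq_sym neq_da.
  by rewrite eq_sym neqT.
have nedge a b : a \in X -> b \in X -> ~~ adj T a b.
  move=> aX bX; apply: contra noedge => ab.
  by apply/exists_inP; exists a => //; apply/exists_inP; exists b.
(* Otherwise the center is the common neighbor of any two points of X. *)
have [/forall_inP single|] := boolP [forall x in X, x == x1].
  by exists x1 => x /single->.
case/forall_inPn=> x2 x2X neq_x21.
have [/(negP (nedge _ _ x2X x1X))//|[c x2c cx1]] := near x2 x1 x2X x1X neq_x21.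
exists c => x xX neq_xc; apply/idPn=> nxc.
have neq_1x : x1 != x by apply: nbrNeq nxc; rewrite aC.
have neq_2x : x2 != x by apply: nbrNeq nxc.
have [|/(negP (nedge _ _ xX x1X))//|[z xz zx1]] := near x x1 xX x1X.
  by rewrite eq_sym.
have neq_cz : c != z by apply: contraNneq nxc => ->.
have neq_2z : x2 != z by apply: contraTneq xz => <-; apply: nedge.
case: (@short x [:: z; x1; c; x2]) => //=.
  by rewrite xz zx1 aC cx1 aC x2c.
rewrite !inE !negb_or neqT // ![x == _]eq_sym neq_1x neq_2x.
rewrite [c == x]eq_sym neq_xc neqT // ![z == _]eq_sym neq_cz neq_2z.
by rewrite [x1 == c]eq_sym neqT // [x1 == x2]eq_sym neq_x21 [c == x2]eq_sym neqT.
Qed.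

(** * Split graphs *)

Lemma split_edge_clique e X Y u v :
  split_partition e X Y -> e u v -> u \notin X -> v \in X.
Proof.
case=> XY _ _ indY euv uNX.
have inXY w : w \notin X -> w \in Y.
  by move=> wNX; have := in_setT w; rewrite -XY inE (negPf wNX).
by apply: contraTT euv => /inXY vY; apply: indY => //; apply: inXY.
Qed.

(** The center of X in a tree of stretch 2 serves as x0 if it lies in X;
    otherwise any vertex of X does. In both cases a vertex [y] of Y not adjacent
    to x0 differs from the center, and so do its neighbors, which are in X and
    hence T-adjacent to the center. Two neighbors [a] and [b] of [y], the first
    one along T, would give the T-path [y, a, c, b] of length 3 between the ends
    of the edge [y b]. *)
Lemma stretch2_center e X Y T x1 :
    simple_graph e -> split_partition e X Y ->
    x1 \in X -> spanning_tree e T -> stretch e T <= 2 ->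
  exists2 x0, x0 \in X & forall y, y \in Y :\: nbhd e x0 -> pendant e y.
Proof.
move=> [sym_e irr_e] split_e x1X sT le2; have aC := adj_sym T.
have [_ disXY cliqueX _] := split_e.
have sub_T u v : adj T u v -> e u v by apply: spanning_tree_sub sT.
have distT u v : e u v -> dist (adj T) u v <= 2.
  by move=> euv; apply: leq_trans (dist_le_stretch T euv) le2.
have [|c cent] := tree_diameter2_center sT x1X.
  by move=> u v uX vX /(cliqueX u v uX vX)/distT.
pose x0 := if c \in X then c else x1.
have x0X : x0 \in X by rewrite /x0; case: ifP.
exists x0 => // y; rewrite !inE => /andP[ne0y yY].
have yNX : y \notin X by apply: contraL yY => yX; rewrite (disjointFr disXY yX).
have neq_yc : y != c.
  apply: contraNneq ne0y => Eyc; rewrite Eyc; apply/sub_T/cent => //.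
  by apply: contraNneq yNX; rewrite Eyc => <-.
have nbrX a : e y a -> a \in X by move/split_edge_clique; apply; eassumption.
have nbrC a : e y a -> adj T a c.
  move=> eya; apply: cent; first exact: nbrX.
  apply: contraNneq ne0y => Eac; have := nbrX a eya.
  by rewrite /x0 -Eac => ->; rewrite sym_e.
have [|a ya] := connected_has_neighbor (e := adj T) (v := c) _ neq_yc.
  by case/and3P: sT.
rewrite /pendant /degree; apply/cards1P; exists a; apply/setP=> b.
rewrite !inE; apply/idP/eqP=> [eyb|->]; last exact: sub_T.
apply/eqP/idPn=> neq_ba; have [ac bc] := (nbrC a (sub_T y a ya), nbrC b eyb).
have neqT u v : adj T u v -> u != v by case/andP.
have neq_yb : y != b by apply: contraNneq yNX => ->; apply: nbrX.
have := @spanning_tree_geodesic e T y [:: a; c; b] sT.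
rewrite /= ya ac aC bc !inE !negb_or (neqT y a) // neq_yc neq_yb (neqT a c) //.
rewrite eq_sym neq_ba eq_sym (neqT b c) // => /(_ isT isT).
by rewrite leqNgt ltnS distT.
Qed.

(** Hang the vertices not adjacent to [x0] below chosen neighbors in X, and
    everything else directly below [x0]. An edge with both ends in the closed
    neighborhood of [x0] gets T-distance at most 2; the other edges join some
    [v] to an [u] in X, along [v, f v, x0, u], unless [u] is the parent [f v],
    as it must be if [v] is pendant. *)
Lemma split_spanning_tree e X Y x0 :
    simple_graph e -> connected_graph e -> split_partition e X Y -> x0 \in X ->
  exists2 T, spanning_tree e T & stretch e T <= 3 /\
    ((forall y, y \in Y :\: nbhd e x0 -> pendant e y) -> stretch e T <= 2).
Proof.
move=> [sym_e irr_e] conn_e split_e x0X; have [XY _ cliqueX _] := split_e.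
(* [f] is the parent map, with [x0] as fixpoint, and [h] the depth. *)
pose near0 v := (v == x0) || e x0 v.
pose f v := if near0 v then x0 else odflt x0 [pick x in X | e v x].
pose h v := if v == x0 then 0 else (~~ e x0 v).+1.
have nearX x : x \in X -> near0 x.
  by move=> xX; rewrite /near0; case: eqVneq => // ?; apply: cliqueX; rewrite // eq_sym.
have f_near v : near0 v -> f v = x0 by rewrite /f => ->.
have f_far v : ~~ near0 v -> f v \in X /\ e v (f v).
  move=> far; rewrite /f (negPf far); case: pickP => [x /andP[] //|none].
  have [|w evw] := @connected_has_neighbor _ e v x0 conn_e.
    by apply: contraNneq far => ->; apply: nearX.
  have wX : w \in X.
    apply: (split_edge_clique split_e evw); apply: contra far; exact: nearX.
  by have := none w; rewrite /= wX evw.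
have ef v : v != x0 -> e v (f v).
  have [nv nv0|/f_far[]//] := boolP (near0 v).
  by rewrite f_near // sym_e; move: nv; rewrite /near0 (negPf nv0).
have hf v : v != x0 -> h (f v) < h v.
  move=> nv0; rewrite {2}/h (negPf nv0).
  have [/f_near->|far] := boolP (near0 v); first by rewrite /h eqxx.
  have [/nearX nf _] := f_far v far; move: nf far.
  rewrite /near0 /h (negPf nv0); case: eqP => //= _ -> -> //.
pose r u v := (u != v) && ((f u == v) || (f v == u)).
have simple_r : simple_graph r.
  by split=> [u v|u]; rewrite /r ?eqxx // eq_sym orbC.
have Er := adj_edges simple_r.
have r_far v : v != x0 -> r v (f v).
  by move=> /ef evf; rewrite /r eqxx andbT; apply: contraTneq evf => <-; rewrite irr_e.
have r_near v : near0 v -> v != x0 -> r v x0.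
  by move=> nv nv0; rewrite -(f_near v nv) r_far.
have f0 : f x0 = x0 by rewrite f_near // nearX.
have rP u v : r u v -> f u = v /\ u != x0 \/ f v = u /\ v != x0.
  case/andP=> neq_uv /orP[] /eqP E; [left|right]; split=> //;
    by apply: contraNneq neq_uv => E0; rewrite -E E0 f0.
pose T := edges r; have [sym_r _] := simple_r.
have conn0 v : connect (adj T) v x0.
  rewrite (eq_connect Er); have [->//|nv0] := eqVneq v x0.
  have [nv|/f_far[fX evf]] := boolP (near0 v); first exact/connect1/r_near.
  apply: connect_trans (connect1 (r_far v nv0)) _.
  have [->//|nf0] := eqVneq (f v) x0.
  by apply/connect1/r_near => //; apply: nearX.
have spanT : spanning_tree e T.
  apply/and3P; split.
  - apply/subsetP=> _ /imsetP[[u v] + ->]; rewrite inE /= mem_edges //.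
    by case/rP=> -[<- /ef //]; rewrite sym_e.
  - apply/andP; split; first by apply/card_gt0P; exists x0.
    apply/forallP=> u; apply/forallP=> v; apply: connect_trans (conn0 u) _.
    by rewrite (sym_connect_sym (adj_sym T)).
  apply: (parent_graph_acyclic (f := f) (h := h)) => u v; rewrite Er.
  by case/rP=> -[<- /hf lt_h]; [left | right].
have distr u p : path r u p -> dist (adj T) u (last u p) <= size p.
  by rewrite -(eq_path Er); apply: dist_le_path.
have near2 u v : near0 u -> near0 v -> u != v -> dist (adj T) u v <= 2.
  move=> nu nv; have [-> neq_0v|nu0] := eqVneq u x0.
    apply: leqW; apply: (distr x0 [:: v]).
    by rewrite /= andbT sym_r r_near // eq_sym.
  have [-> _|nv0 _] := eqVneq v x0.
    by apply: leqW; apply: (distr u [:: x0]); rewrite /= andbT r_near.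
  by apply: (distr u [:: x0; v]); rewrite /= r_near // sym_r r_near.
have bound k : 1 < k -> (2 < k \/ forall y, ~~ near0 y -> pendant e y) ->
    stretch e T <= k.
  move=> k_gt1 k_far.
  have far v u : ~~ near0 v -> e v u ->
      dist (adj T) u v <= k /\ dist (adj T) v u <= k.
    move=> far evu; have [fX evf] := f_far v far.
    have := far; rewrite negb_or => /andP[nv0 ne0v].
    have nbr0 w : e v w -> w != x0.
      by move=> evw; apply: contraNneq ne0v => <-; rewrite sym_e.
    have rfv : r v (f v) by apply: r_far.
    have [->|neq_uf] := eqVneq u (f v).
      split; apply: leq_trans (ltnW k_gt1).
        by apply: (distr (f v) [:: v]); rewrite /= sym_r rfv.
      by apply: (distr v [:: f v]); rewrite /= rfv.
    (* A pendant [v] has only its parent as neighbor. *)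
    case: k_far => [k_gt2|/(_ v far)]; last first.
      case/cards1P=> z Ez; case/eqP: neq_uf.
      have nz w : e v w -> w = z.
        by move=> evw; apply/set1P; rewrite -Ez inE.
      by rewrite (nz u) // (nz (f v)).
    have r0f : r (f v) x0 by apply: r_near; [apply: nearX | apply: nbr0].
    have uX : u \in X.
      by apply: (split_edge_clique split_e evu); apply: contra far; apply: nearX.
    have r0u : r u x0 by apply: r_near; [apply: nearX | apply: nbr0].
    split; apply: leq_trans k_gt2.
      apply: (distr u [:: x0; f v; v]).
      by rewrite /= r0u sym_r r0f sym_r rfv.
    apply: (distr v [:: f v; x0; u]).
    by rewrite /= rfv r0f sym_r r0u.
  apply/bigmax_leqP=> -[u v] /= euv.
  have [nu|/far/(_ euv)[]//] := boolP (near0 u).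
  have [nv|fv] := boolP (near0 v); last by case: (far v u fv); rewrite // sym_e.
  apply: leq_trans k_gt1; apply: near2 => //.
  by apply: contraTneq euv => ->; rewrite irr_e.
exists T => //; split; first by apply: bound => //; left.
move=> cond; apply: bound => //; right=> y fy; apply: cond.
have := in_setT y; rewrite -XY !inE; move: (fy); rewrite negb_or => /andP[_ ->].
by case/orP=> // /nearX; rewrite (negPf fy).
Qed.

(** A graph with a cycle has an edge, and one of its ends is in X. *)
Lemma split_clique_nonempty e X Y :
    connected_graph e -> ~~ is_tree e -> split_partition e X Y ->
  exists x, x \in X.
Proof.
move=> conn_e not_tree split_e; apply/set0Pn; apply: contraNneq not_tree => X0.
rewrite /is_tree conn_e; apply/acyclicP=> -[|u [|v p]] // /andP[].
by case/andP=> /(split_edge_clique split_e); rewrite X0 !inE => /(_ isT).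
Qed.

End SpanningTrees.

Theorem theorem3p2 (V : finType) (e : rel V) (X Y : {set V})
    (simple_e : simple_graph e) (connected_e : connected_graph e)
    (not_tree_e : ~~ is_tree e) (split_e : split_partition e X Y) :
  (tree_stretch e = 2 <->
     exists2 x0, x0 \in X & forall y, y \in Y :\: nbhd e x0 -> pendant e y) /\
  (~ (exists2 x0, x0 \in X & forall y, y \in Y :\: nbhd e x0 -> pendant e y) ->
     tree_stretch e = 3).
Proof.
have [x1 x1X] := split_clique_nonempty connected_e not_tree_e split_e.
have [T0 sT0 [T0_le3 _]] :=
  split_spanning_tree simple_e connected_e split_e x1X.
have [T sT ET] := tree_stretch_attained sT0.
have gt1 : 1 < tree_stretch e by rewrite ET stretch_gt1.
have le3 : tree_stretch e <= 3 := leq_trans (tree_stretch_min sT0) T0_le3.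
have stretch2 : tree_stretch e = 2 ->
    exists2 x0, x0 \in X & forall y, y \in Y :\: nbhd e x0 -> pendant e y.
  by move=> E2; apply: (stretch2_center simple_e split_e x1X sT); rewrite -ET E2.
split; first split=> // [[x0 x0X cond]].
  have [T2 sT2 [_ /(_ cond) le2]] :=
    split_spanning_tree simple_e connected_e split_e x0X.
  by apply/eqP; rewrite eqn_leq gt1 (leq_trans (tree_stretch_min sT2)).
move=> no_center; apply/eqP; rewrite eqn_leq le3 /= ltn_neqAle gt1 andbT.
by apply/eqP=> /esym/stretch2.
Qed.
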